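(* Let $S$ be a semiring with enough $S$-$i$-injective left semimodules, i.e. such that every left $S$-semimodule can be embedded into an $S$-$i$-injective left $S$-semimodule. If every direct sum of $S$-$i$-injective left $S$-semimodules is $S$-$i$-injective, then $S$ is left $k$-Noetherian.
   Context: A semiring $(S,+,0,\cdot,1)$ consists of a commutative monoid $(S,+,0)$ and a (not necessarily commutative) monoid $(S,\cdot,1)$ with $0\neq 1$, such that $a\cdot 0=0=0\cdot a$, $a(b+c)=ab+ac$ and $(a+b)c=ac+bc$ for all $a,b,c\in S$. A left $S$-semimodule is a commutative monoid $(M,+,0_M)$ with a unital, associative left action of $S$ that is additive in both variables and satisfies $0\cdot m=0_M=s\cdot 0_M$ (i.e., a module, but not necessarily with subtraction); $S$ is a left semimodule over itself, and its subsemimodules are the left ideals of $S$. A subsemimodule $L\leq_S M$ is subtractive if $L=\overline{L}$, where $\overline{L}:=\{m\in M\mid m+\ell=\ell' \text{ for some } \ell,\ell'\in L\}$. An $S$-linear map $f:L\to M$ is a normal monomorphism if it is injective and its image $f(L)$ is a subtractive subsemimodule of $M$. A left $S$-semimodule $I$ is $S$-$i$-injective if for every left $S$-semimodule $L$, every normal monomorphism $f:L\to S$ and every $S$-linear map $g:L\to I$, there exists an $S$-linear map $h:S\to I$ such that $h\circ f=g$. An embedding is an injective $S$-linear map. The direct sum $\bigoplus_{a\in A}J_a$ of a (possibly infinite) family of left $S$-semimodules is the subsemimodule of the product $\prod_{a\in A}J_a$ consisting of the families with finite support. The semiring $S$ is left $k$-Noetherian if every ascending chain of subtractive left ideals of $S$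 terminates, i.e. becomes stationary. *)

(* Defs.v *)
From HB Require Import structures.
From mathcomp Require Import all_boot all_order all_algebra.
From mathcomp Require Import boolp classical_sets functions cardinality.

Set Implicit Arguments.
Unset Strict Implicit.
Unset Printing Implicit Defensive.

Import GRing.Theory.

Local Open Scope classical_set_scope.
Local Open Scope ring_scope.

(* A semiring with 0 != 1 is an [S : nzSemiRingType], a left S-semimodule is an
   [M : lSemiModType S], and S as a left semimodule over itself is [S^o]. *)

Section Subtractive.
Context (S : nzSemiRingType) (M : lSemiModType S).

Definition subtractive_closure (L : set M) : set M :=
  [set m | exists l l', [/\ L l, L l' & m + l = l']].

Definition subtractive_subsemimodule (L : set M) : Prop :=
  GRing.subsemimod_closed [in L] /\ L = subtractive_closure L.

End Subtractive.

Definition normal_mono (S : nzSemiRingType) (L M : lSemiModType S)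
    (f : {linear L -> M}) : Prop :=
  injective f /\ subtractive_subsemimodule (range f).

Definition i_injective (S : nzSemiRingType) (I : lSemiModType S) : Prop :=
  forall (L : lSemiModType S) (f : {linear L -> S^o}) (g : {linear L -> I}),
    normal_mono f -> exists h : {linear S^o -> I}, h \o f =1 g.

Definition enough_i_injectives (S : nzSemiRingType) : Prop :=
  forall M : lSemiModType S,
    exists (I : lSemiModType S) (f : {linear M -> I}),
      i_injective I /\ injective f.

Definition left_k_Noetherian (S : nzSemiRingType) : Prop :=
  forall I : nat -> set S^o,
    (forall n, subtractive_subsemimodule (I n)) ->
    (forall n, I n `<=` I n.+1) ->
    exists N, forall n, (N <= n)%N -> I n = I N.

Section DirectProduct.
Context (S : nzSemiRingType) (A : Type) (J : A -> lSemiModType S).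

(* A named copy of the dependent function type, so that the pointwise instances
   below do not compete with those of MathComp-Analysis on [A -> M]. *)
Definition dirprod : Type := forall a, J a.

HB.instance Definition _ := Choice.copy dirprod (forall a, J a).

Let zero : dirprod := fun=> 0.
Let add (f g : dirprod) : dirprod := fun a => f a + g a.
Let scale (s : S) (f : dirprod) : dirprod := fun a => s *: f a.

Let addA : associative add.
Proof. by move=> f g h; apply: functional_extensionality_dep => a; apply: addrA. Qed.
Let addC : commutative add.
Proof. by move=> f g; apply: functional_extensionality_dep => a; apply: addrC. Qed.
Let add0 : left_id zero add.
Proof. by move=> f; apply: functional_extensionality_dep => a; apply: add0r. Qed.

HB.instance Definition _ := GRing.isNmodule.Build dirprod addA addC add0.

Let scaleA s t f : scale s (scale t f) = scale (s * t) f.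
Proof. by apply: functional_extensionality_dep => a; apply: scalerA. Qed.
Let scale0 f : scale 0 f = 0.
Proof. by apply: functional_extensionality_dep => a; apply: scale0r. Qed.
Let scale1 : left_id 1 scale.
Proof. by move=> f; apply: functional_extensionality_dep => a; apply: scale1r. Qed.
Let scaleDr : right_distributive scale +%R.
Proof. by move=> s f g; apply: functional_extensionality_dep => a; apply: scalerDr. Qed.
Let scaleDl f : {morph scale^~ f : s t / s + t}.
Proof. by move=> s t; apply: functional_extensionality_dep => a; apply: scalerDl. Qed.

HB.instance Definition _ := GRing.Nmodule_isLSemiModule.Build S dirprod
  scaleA scale0 scale1 scaleDr scaleDl.

End DirectProduct.

Section DirectSum.
Context (S : nzSemiRingType) (A : Type) (J : A -> lSemiModType S).

Definition finite_support : {pred dirprod J} :=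
  fun f => `[< finite_set [set a | f a <> 0] >].

Lemma finite_support_closed : GRing.subsemimod_closed finite_support.
Proof.
split; first split.
- apply/asboolP; apply: sub_finite_set (finite_set0 A) => a /=; exact.
- move=> f g /asboolP ff /asboolP fg; apply/asboolP.
  have fU : finite_set ([set a | f a <> 0] `|` [set a | g a <> 0]).
    by rewrite finite_setU.
  apply: sub_finite_set fU => a /= fga0.
  have [fa0|fa0] := pselect (f a = 0); [right => ga0 | by left].
  by apply: fga0; rewrite -[RHS](addr0 0); congr (_ + _).
- move=> s f /asboolP ff; apply/asboolP; apply: sub_finite_set ff => a /= sfa0.
  by move=> fa0; apply: sfa0; apply: etrans (scaler0 _ s); congr (_ *: _).
Qed.

HB.instance Definition _ :=
  GRing.isSubSemiModClosed.Build S (dirprod J) finite_support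
    finite_support_closed.

Record dirsum : Type := DirSum {
  dirsum_val : dirprod J;
  _ : dirsum_val \in finite_support
}.

HB.instance Definition _ := [isSub for dirsum_val].
HB.instance Definition _ := [Choice of dirsum by <:].
HB.instance Definition _ := [SubChoice_isSubLSemiModule of dirsum by <:].

End DirectSum.

Arguments dirprod {S A} J.
Arguments dirsum {S A} J.

(* Main.v *)
Require Import Defs.
From mathcomp Require Import all_boot all_order all_algebra.
From HB Require Import structures.
From mathcomp Require Import boolp classical_sets functions cardinality.
From mathcomp Require Import generic_quotient.

(** The argument follows the classical Bass-Papp proof, with subtractive
    ideals in place of ideals.

    Let [I 0 <= I 1 <= ...] be an ascending chain of subtractive left ideals
    and [U] its union.  Since the chain is directed, [U] is again a subtractive
    left ideal ([subtractive_bigcup_chain]), so its inclusion in [S] is a normal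
    monomorphism.  Each quotient [S / I n] embeds by some [e n] into an
    i-injective semimodule [J n].  An element of [U] lies in [I n] for all large
    [n], hence dies in almost all quotients, and [x |-> (e n (x mod I n))_n] is
    a linear map from [U] to the direct sum of the [J n] ([dirsum_lift]).  That
    sum is i-injective, so the map extends to a linear [h] on the whole of [S].

    Now [h x = x *: h 1], so the finite support of the single element [h 1]
    bounds the support of all values of [h] ([linear_dirsum_finite_support]).
    For an index [N] outside it, every [x] of [U] is zero in [S / I N].

    Without subtraction, the quotient is the one by the Bourne congruence, and
    the class of [x] is zero exactly when [x] is in the subtractive closure of
    [I N] ([bourne_pi_eq0]).  As [I N] is subtractive, this says that [x] is in
    [I N].  Therefore [U] is contained in [I N], and the chain is stationary
    from [N] on. *)

Set Implicit Arguments.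
Unset Strict Implicit.
Unset Printing Implicit Defensive.

Import GRing.Theory.

Local Open Scope classical_set_scope.
Local Open Scope ring_scope.
Local Open Scope quotient_scope.

(** * Closure properties of a subsemimodule given as a set *)

Section SubsemimodClosed.
Context (S : nzSemiRingType) (M : lSemiModType S) (L : set M).
Hypothesis L_closed : GRing.subsemimod_closed [in L].

Lemma subsemimod0 : L 0.
Proof. by case: L_closed => [[/set_mem]]. Qed.

Lemma subsemimodD x y : L x -> L y -> L (x + y).
Proof.
by case: L_closed => [[_ LD]] _ /mem_set Lx /mem_set Ly; apply/set_mem/LD.
Qed.

Lemma subsemimodZ s x : L x -> L (s *: x).
Proof. by case: L_closed => _ LZ /mem_set Lx; apply/set_mem/LZ. Qed.

End SubsemimodClosed.

(** * The quotient of a semimodule by a subsemimodule *)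

Section BourneQuotient.
Context (S : nzSemiRingType) (M : lSemiModType S) (L : set M).
Hypothesis L_closed : GRing.subsemimod_closed [in L].

(** Differences being unavailable, congruence modulo [L] adds an element of [L]
    on each side.  This is the least congruence that identifies all the elements
    of [L] with zero. *)
Definition bourne : rel M :=
  fun x y => `[< exists a b, [/\ L a, L b & x + a = y + b] >].

Lemma bourne_refl : reflexive bourne.
Proof.
by move=> x; apply/asboolP; exists 0, 0; split=> //; apply: subsemimod0.
Qed.

Lemma bourne_sym : symmetric bourne.
Proof.
by move=> x y; apply/asboolP/asboolP => -[a [b [La Lb xy]]]; exists b, a; split.
Qed.

Lemma bourne_trans : transitive bourne.
Proof.
move=> y x z /asboolP[a [b [La Lb xy]]] /asboolP[c [d [Lc Ld yz]]].
apply/asboolP; exists (a + c), (d + b); split; try exact: subsemimodD.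
by rewrite addrA xy addrAC yz addrA.
Qed.

Definition bourne_equiv := EquivRel bourne bourne_refl bourne_sym bourne_trans.

Definition bourne_quot : Type := {eq_quot bourne_equiv}.

HB.instance Definition _ := Choice.on bourne_quot.
HB.instance Definition _ := EqQuotient.on bourne_quot.

Definition bourne_pi (x : M) : bourne_quot := \pi_bourne_quot x.

Lemma bourne_piP x y : reflect (exists a b, [/\ L a, L b & x + a = y + b])
  (bourne_pi x == bourne_pi y).
Proof. by rewrite /bourne_pi eqquotE; apply: asboolP. Qed.

Lemma bourne_ind (P : bourne_quot -> Prop) :
  (forall x, P (bourne_pi x)) -> forall q, P q.
Proof. by move=> Ppi q; rewrite -[q]reprK; apply: Ppi. Qed.

(** The operations on the quotient are defined through representatives; this
    relation between [x] and the representative of its class shows that they do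
    not depend on the choice. *)
Lemma repr_bourne_pi x :
  exists a b, [/\ L a, L b & repr (bourne_pi x) + a = x + b].
Proof. by apply/bourne_piP; rewrite /bourne_pi reprK. Qed.

Let zero : bourne_quot := bourne_pi 0.
Let add (p q : bourne_quot) : bourne_quot := bourne_pi (repr p + repr q).
Let scale (s : S) (q : bourne_quot) : bourne_quot := bourne_pi (s *: repr q).

Let addE x y : add (bourne_pi x) (bourne_pi y) = bourne_pi (x + y).
Proof.
have [a [b [La Lb xE]]] := repr_bourne_pi x.
have [c [d [Lc Ld yE]]] := repr_bourne_pi y.
apply/eqP/bourne_piP; exists (a + c), (b + d).
by split; try exact: subsemimodD; rewrite addrACA xE yE addrACA.
Qed.

Let scaleE s x : scale s (bourne_pi x) = bourne_pi (s *: x).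
Proof.
have [a [b [La Lb xE]]] := repr_bourne_pi x.
apply/eqP/bourne_piP; exists (s *: a), (s *: b).
by split; try exact: subsemimodZ; rewrite -!scalerDr xE.
Qed.

Let addA : associative add.
Proof.
elim/bourne_ind=> x; elim/bourne_ind=> y; elim/bourne_ind=> z.
by rewrite !addE addrA.
Qed.
Let addC : commutative add.
Proof.
by elim/bourne_ind=> x; elim/bourne_ind=> y; rewrite !addE addrC.
Qed.
Let add0 : left_id zero add.
Proof. by elim/bourne_ind=> x; rewrite addE add0r. Qed.

HB.instance Definition _ := GRing.isNmodule.Build bourne_quot addA addC add0.

Let scaleA s t q : scale s (scale t q) = scale (s * t) q.
Proof. by elim/bourne_ind: q => x; rewrite !scaleE scalerA. Qed.
Let scale0 q : scale 0 q = 0.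
Proof. by elim/bourne_ind: q => x; rewrite scaleE scale0r. Qed.
Let scale1 : left_id 1 scale.
Proof. by elim/bourne_ind=> x; rewrite scaleE scale1r. Qed.
Let scaleDr : right_distributive scale +%R.
Proof.
move=> s; elim/bourne_ind=> x; elim/bourne_ind=> y.
by rewrite [_ + _]addE !scaleE [RHS]addE scalerDr.
Qed.
Let scaleDl q : {morph scale^~ q : s t / s + t}.
Proof.
by elim/bourne_ind: q => x s t; rewrite !scaleE [RHS]addE scalerDl.
Qed.

HB.instance Definition _ := GRing.Nmodule_isLSemiModule.Build S bourne_quot
  scaleA scale0 scale1 scaleDr scaleDl.

Fact bourne_pi_semilinear : semilinear bourne_pi.
Proof. by split=> [s x|x y]; [rewrite -scaleE|rewrite -addE]. Qed.

HB.instance Definition _ :=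
  GRing.isSemilinear.Build S M bourne_quot _ bourne_pi bourne_pi_semilinear.

(** Collapsing [L] also collapses its subtractive closure and nothing more.
    This is where subtractivity enters: only a subtractive [L] can be recovered
    from its quotient. *)
Lemma bourne_pi_eq0 x : (bourne_pi x = 0) <-> subtractive_closure L x.
Proof.
split=> [/eqP/bourne_piP[a [b [La Lb]]]|[a [b [La Lb xab]]]].
  by rewrite add0r; exists a, b.
by apply/eqP/bourne_piP; exists a, b; rewrite add0r.
Qed.

End BourneQuotient.

(** * A subsemimodule as a semimodule of its own *)

Section Carrier.
Context (S : nzSemiRingType) (M : lSemiModType S) (L : set M).
Hypothesis L_closed : GRing.subsemimod_closed [in L].

(** The proof of closure is an argument of the predicate so that the closedness
    instance, and with it the semimodule structure of [carrier], can be inferred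
    for a set that satisfies the closure properties only by hypothesis. *)
Definition carrier_pred of GRing.subsemimod_closed [in L] : {pred M} := [in L].

HB.instance Definition _ :=
  GRing.isSubSemiModClosed.Build S M (carrier_pred L_closed) L_closed.

Record carrier : Type := Carrier {
  carrier_val : M;
  _ : carrier_val \in carrier_pred L_closed
}.

HB.instance Definition _ := [isSub for carrier_val].
HB.instance Definition _ := [Choice of carrier by <:].
HB.instance Definition _ := [SubChoice_isSubLSemiModule of carrier by <:].

Lemma range_carrier_val : range (val : carrier -> M) = L.
Proof.
apply/seteqP; split=> [_ [u _ <-]|x Lx]; first exact: set_mem (valP u).
by exists (Carrier (mem_set Lx : x \in carrier_pred L_closed)).
Qed.

End Carrier.

(** * Linear maps into a direct sum *)

Section IntoDirectSum.
Context (S : nzSemiRingType) (A : Type) (J : A -> lSemiModType S).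

(** The finiteness hypothesis is pointwise: the support may depend on [x] and
    need not be bounded as [x] varies. *)
Lemma dirsum_lift (M : lSemiModType S) (phi : forall a, {linear M -> J a}) :
    (forall x, finite_set [set a | phi a x <> 0]) ->
  exists g : {linear M -> dirsum J}, forall x a, val (g x) a = phi a x.
Proof.
move=> phi_fin.
have phi_supp x : ((fun a => phi a x) : dirprod J) \in @finite_support S A J.
  exact/asboolP.
pose g x := DirSum (phi_supp x).
have g_semilinear : semilinear g.
  split=> [s x|x y]; apply: val_inj; apply: functional_extensionality_dep => a.
    exact: linearZ.
  exact: linearD.
pose gS := GRing.isSemilinear.Build S M (dirsum J) _ g g_semilinear.
pose gL : {linear M -> dirsum J} := HB.pack g gS.
by exists gL.
Qed.

(** On the cyclic semimodule [S] the support is uniformly bounded: every value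
    is a multiple of [h 1], so the support of [h 1] serves for all [x]. *)
Lemma linear_dirsum_finite_support (h : {linear S^o -> dirsum J}) :
  exists F : set A, finite_set F /\ forall x a, ~ F a -> val (h x) a = 0.
Proof.
exists [set a | val (h 1) a <> 0]; split; first exact/asboolP/(valP (h 1)).
move=> x a /= /contrapT h1a0.
have -> : h x = (x : S) *: h 1.
  by rewrite -[in RHS]linearZ; congr (h _); apply: esym (mulr1 x).
apply: etrans (scaler0 _ x); exact: (congr1 (fun y => x *: y) h1a0).
Qed.

End IntoDirectSum.

(** * The union of an ascending chain *)

Section AscendingChain.
Context (S : nzSemiRingType) (M : lSemiModType S) (I : nat -> set M).
Hypothesis I_sub : forall n, subtractive_subsemimodule (I n).
Hypothesis I_incr : forall n, I n `<=` I n.+1.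

Lemma chain_le m n : (m <= n)%N -> I m `<=` I n.
Proof.
apply: homo_leq => // [? ?|? ? ?]; first exact: subset_refl.
exact: subset_trans.
Qed.

Lemma chain_common x y : (\bigcup_n I n) x -> (\bigcup_n I n) y ->
  exists n, I n x /\ I n y.
Proof.
move=> [m _ Imx] [n _ Iny]; exists (maxn m n).
split; first by apply: chain_le Imx; exact: leq_maxl.
by apply: chain_le Iny; exact: leq_maxr.
Qed.

(** Both the closure under sums and subtractivity involve only two members of
    the union at a time, and these lie in a common term of the chain. *)
Lemma subtractive_bigcup_chain : subtractive_subsemimodule (\bigcup_n I n).
Proof.
split.
  split; first split.
  - by apply/mem_set; exists 0%N => //; apply: subsemimod0; case: (I_sub 0).
  - move=> x y /set_mem Ux /set_mem Uy; apply/mem_set.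
    have [n [Ix Iy]] := chain_common Ux Uy.
    by exists n => //; apply: subsemimodD => //; case: (I_sub n).
  - move=> s x /set_mem[n _ Ix]; apply/mem_set.
    by exists n => //; apply: subsemimodZ => //; case: (I_sub n).
apply/seteqP; split=> [x [n _]|x [a [b [Ua Ub xab]]]].
  rewrite (I_sub n).2 => -[a [b [Ia Ib xab]]].
  by exists a, b; split=> //; exists n.
have [n [Ia Ib]] := chain_common Ua Ub.
by exists n => //; rewrite (I_sub n).2; exists a, b.
Qed.

End AscendingChain.

(** * Stationarity of chains of subtractive left ideals *)

Theorem theorem2p19 (S : nzSemiRingType) :
  enough_i_injectives S ->
  (forall (A : Type) (J : A -> lSemiModType S),
      (forall a : A, i_injective (J a)) -> i_injective (dirsum J)) ->
  left_k_Noetherian S.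
Proof.
move=> enough dirsum_inj I I_sub I_incr.
have I_closed n : GRing.subsemimod_closed [in I n] by case: (I_sub n).
have U_sub := subtractive_bigcup_chain I_sub I_incr.
have U_closed := U_sub.1.
pose U := carrier U_closed.
pose J n := projT1 (cid (enough (bourne_quot (I_closed n)))).
have embJ n : exists e : {linear bourne_quot (I_closed n) -> J n},
    i_injective (J n) /\ injective e.
  exact: (projT2 (cid (enough (bourne_quot (I_closed n))))).
pose e n := projT1 (cid (embJ n)).
have J_inj n : i_injective (J n) by case: (projT2 (cid (embJ n))).
have e_inj n : injective (e n) by case: (projT2 (cid (embJ n))).
pose phi n : {linear U -> J n} := e n \o (bourne_pi (I_closed n) \o val).
have phi_eq0 n u : phi n u = 0 <-> I n (val u).
  rewrite [X in _ <-> X _](I_sub n).2 -(bourne_pi_eq0 (I_closed n)).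
  split=> [phi0|pi0]; first by apply: (e_inj n); rewrite linear0.
  by rewrite /phi /= pi0 linear0.
have phi_fin u : finite_set [set n | phi n u <> 0].
  have [m _ Imu] := set_mem (valP u).
  apply: sub_finite_set (finite_II m) => n /= phi_nz.
  rewrite ltnNge; apply/negP => le_mn; apply/phi_nz/phi_eq0.
  exact: chain_le Imu.
have [g gE] := dirsum_lift phi_fin.
have U_normal : normal_mono (val : {linear U -> S^o}).
  by split; [exact: val_inj|rewrite range_carrier_val].
have [h hE] := dirsum_inj _ _ J_inj _ _ g U_normal.
have [F [F_fin F_out]] := linear_dirsum_finite_support h.
have [N NF] : exists N, ~ F N.
  apply: contrapT => allF; apply: infinite_nat; apply: sub_finite_set F_fin.
  by move=> n _; apply: contrapT => nF; apply: allF; exists n.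
exists N => n le_Nn; apply/seteqP; split; last exact: chain_le.
move=> x Inx.
have Ux : x \in carrier_pred U_closed by apply/mem_set; exists n.
apply/(phi_eq0 N (Carrier Ux)).
by rewrite -gE -hE; apply: F_out.
Qed.
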